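(* The following are equivalent for a functor $G:\mathcal{D}\to\mathcal{C}$. (1) $G$ is a naturally full coreflection. (2) $G$ is a semiseparable coreflection. (3) $G$ is a bireflection. (4) $G$ is a Frobenius coreflection. (5) $G$ is a naturally full reflection. (6) $G$ is a semiseparable reflection. (7) $G$ is a Frobenius reflection.
   Context: For a functor $F:\mathcal{C}\to\mathcal{D}$ let $\mathcal{F}^F:\mathrm{Hom}_{\mathcal{C}}(-,-)\to\mathrm{Hom}_{\mathcal{D}}(F-,F-)$ be the natural transformation (of functors $\mathcal{C}^{\mathrm{op}}\times\mathcal{C}\to\mathsf{Set}$) with $\mathcal{F}^F_{X,Y}(f)=F(f)$. $F$ is naturally full if there is a natural transformation $\mathcal{P}^F:\mathrm{Hom}_{\mathcal{D}}(F-,F-)\to\mathrm{Hom}_{\mathcal{C}}(-,-)$ with $\mathcal{F}^F\circ\mathcal{P}^F=\mathrm{Id}$; semiseparable if there is such a $\mathcal{P}^F$ with $\mathcal{F}^F\circ\mathcal{P}^F\circ\mathcal{F}^F=\mathcal{F}^F$. A functor is a coreflection if it has a fully faithful left adjoint, a reflection if it has a fully faithful right adjoint, and Frobenius if there is a functor that is both a left and a right adjoint to it. A functor $G:\mathcal{D}\to\mathcal{C}$ is a bireflection if it has a left and right adjoint equal, say $F:\mathcal{C}\to\mathcal{D}$, which is fully faithful and satisfies the coherence condition $\gamma\circ\epsilon=\mathrm{Id}_{FG}$, where $\epsilon:FG\to\mathrm{Id}_{\mathcal{D}}$ is the counit of $F\dashv G$ and $\gamma:\mathrm{Id}_{\mathcal{D}}\to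 FG$ is the unit of $G\dashv F$. *)

(* Defs.v *)
(* Categories with hom-types in Type and Leibniz equality of morphisms. *)
From mathcomp Require Import all_boot.
From mathcomp Require Import boolp.

Set Implicit Arguments.
Unset Strict Implicit.
Unset Printing Implicit Defensive.

Declare Scope cat_scope.
Delimit Scope cat_scope with cat.
Local Open Scope cat_scope.

Record category := Category {
  obj :> Type;
  hom : obj -> obj -> Type;
  idm : forall X, hom X X;
  compm : forall X Y Z, hom Y Z -> hom X Y -> hom X Z;
  compm1 : forall X Y (f : hom X Y), compm f (idm X) = f;
  comp1m : forall X Y (f : hom X Y), compm (idm Y) f = f;
  compmA : forall W X Y Z (h : hom Y Z) (g : hom X Y) (f : hom W X),
    compm h (compm g f) = compm (compm h g) f }.

Arguments hom {c} X Y.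
Arguments idm {c} X.
Arguments compm {c X Y Z} g f.

Notation "g ∘ f" := (compm g f) (at level 40, left associativity) : cat_scope.

Record functor (C D : category) := Functor {
  fobj :> C -> D;
  fmap : forall X Y : C, hom X Y -> hom (fobj X) (fobj Y);
  fmap1 : forall X : C, fmap (idm X) = idm (fobj X);
  fmapM : forall (X Y Z : C) (g : hom Y Z) (f : hom X Y),
    fmap (g ∘ f) = fmap g ∘ fmap f }.

Arguments fmap {C D} f {X Y} _ : rename.

Record nattrans (C D : category) (F G : functor C D) := Nattrans {
  component :> forall X : C, hom (F X) (G X);
  naturality : forall (X Y : C) (f : hom X Y),
    fmap G f ∘ component X = component Y ∘ fmap F f }.

Arguments component {C D F G} _ X.

Lemma nattrans_ext (C D : category) (F G : functor C D) (a b : nattrans F G) :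
  (forall X, a X = b X) -> a = b.
Proof.
case: a b => [a na] [b nb] /= ab.
have e : a = b by apply: functional_extensionality_dep.
by case: _ / e nb => nb; congr Nattrans; apply: Prop_irrelevance.
Qed.

Section Identities.
Variables (C D : category).

Definition id_functor : functor C C :=
  @Functor C C id (fun _ _ f => f) (fun _ => erefl) (fun _ _ _ _ _ => erefl).

Lemma id_nattrans_natural (F : functor C D) (X Y : C) (f : hom X Y) :
  fmap F f ∘ idm (F X) = idm (F Y) ∘ fmap F f.
Proof. by rewrite compm1 comp1m. Qed.

Definition id_nattrans (F : functor C D) : nattrans F F :=
  Nattrans (@id_nattrans_natural F).

End Identities.

Arguments id_functor C : clear implicits.
Arguments id_nattrans {C D} F.

Section FunctorComposition.
Variables (C D E : category) (G : functor D E) (F : functor C D).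

Lemma comp_functor1 (X : C) : fmap G (fmap F (idm X)) = idm (G (F X)).
Proof. by rewrite !fmap1. Qed.

Lemma comp_functorM (X Y Z : C) (g : hom Y Z) (f : hom X Y) :
  fmap G (fmap F (g ∘ f)) = fmap G (fmap F g) ∘ fmap G (fmap F f).
Proof. by rewrite !fmapM. Qed.

Definition comp_functor : functor C E :=
  @Functor C E (fun X => G (F X)) (fun _ _ f => fmap G (fmap F f))
    comp_functor1 comp_functorM.

End FunctorComposition.

Section VerticalComposition.
Variables (C D : category) (F G H : functor C D).
Variables (b : nattrans G H) (a : nattrans F G).

Lemma comp_nattrans_natural (X Y : C) (f : hom X Y) :
  fmap H f ∘ (b X ∘ a X) = b Y ∘ a Y ∘ fmap F f.
Proof. by rewrite compmA naturality -!compmA naturality. Qed.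

Definition comp_nattrans : nattrans F H := Nattrans comp_nattrans_natural.

End VerticalComposition.

Notation "G \oF F" := (comp_functor G F)
  (at level 40, left associativity) : cat_scope.
Notation "b \oN a" := (comp_nattrans b a)
  (at level 40, left associativity) : cat_scope.

(* The category playing the role of Set. *)
Definition type_cat : category :=
  @Category Type (fun A B => A -> B) (fun _ x => x)
    (fun _ _ _ g f x => g (f x))
    (fun _ _ _ => erefl) (fun _ _ _ => erefl) (fun _ _ _ _ _ _ _ => erefl).

Definition op_cat (C : category) : category :=
  @Category C (fun X Y => @hom C Y X) (fun X => idm X)
    (fun _ _ _ g f => f ∘ g)
    (fun _ _ f => comp1m f) (fun _ _ f => compm1 f)
    (fun _ _ _ _ h g f => esym (compmA f g h)).

Definition op_functor (C D : category) (F : functor C D) :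
    functor (op_cat C) (op_cat D) :=
  @Functor (op_cat C) (op_cat D) F (fun X Y f => @fmap C D F Y X f)
    (fun X => fmap1 F X) (fun _ _ _ g f => fmapM F f g).

Section Product.

Definition prod_hom (C D : category) (X Y : C * D) : Type :=
  (hom X.1 Y.1 * hom X.2 Y.2)%type.

Definition prod_idm (C D : category) (X : C * D) : prod_hom X X :=
  (idm X.1, idm X.2).

Definition prod_compm (C D : category) (X Y Z : C * D)
    (g : prod_hom Y Z) (f : prod_hom X Y) : prod_hom X Z :=
  (g.1 ∘ f.1, g.2 ∘ f.2).

Lemma prod_compm1 (C D : category) (X Y : C * D) (f : prod_hom X Y) :
  prod_compm f (prod_idm X) = f.
Proof. by case: f => f1 f2; congr pair; apply: compm1. Qed.

Lemma prod_comp1m (C D : category) (X Y : C * D) (f : prod_hom X Y) :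
  prod_compm (prod_idm Y) f = f.
Proof. by case: f => f1 f2; congr pair; apply: comp1m. Qed.

Lemma prod_compmA (C D : category) (W X Y Z : C * D)
    (h : prod_hom Y Z) (g : prod_hom X Y) (f : prod_hom W X) :
  prod_compm h (prod_compm g f) = prod_compm (prod_compm h g) f.
Proof. by congr pair; apply: compmA. Qed.

Definition prod_cat (C D : category) : category :=
  @Category (C * D)%type (@prod_hom C D) (@prod_idm C D) (@prod_compm C D)
    (@prod_compm1 C D) (@prod_comp1m C D) (@prod_compmA C D).

Variables (A B C D : category) (F : functor A C) (G : functor B D).

Definition prod_fmap (X Y : prod_cat A B) (f : hom X Y) :
    @hom (prod_cat C D) (F X.1, G X.2) (F Y.1, G Y.2) :=
  (fmap F f.1, fmap G f.2).

Lemma prod_fmap1 (X : prod_cat A B) :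
  prod_fmap (idm X) = @idm (prod_cat C D) (F X.1, G X.2).
Proof. by congr pair; apply: fmap1. Qed.

Lemma prod_fmapM (X Y Z : prod_cat A B) (g : hom Y Z) (f : hom X Y) :
  prod_fmap (g ∘ f) = prod_fmap g ∘ prod_fmap f.
Proof. by congr pair; apply: fmapM. Qed.

Definition prod_functor : functor (prod_cat A B) (prod_cat C D) :=
  @Functor (prod_cat A B) (prod_cat C D) (fun X => (F X.1, G X.2)) prod_fmap
    prod_fmap1 prod_fmapM.

End Product.

Section HomFunctor.
Variable C : category.

Definition hom_obj (X : prod_cat (op_cat C) C) : type_cat := @hom C X.1 X.2.

Definition hom_map (X Y : prod_cat (op_cat C) C) (u : hom X Y) :
    hom (hom_obj X) (hom_obj Y) :=
  fun h : @hom C X.1 X.2 => @compm C _ _ _ u.2 (@compm C _ _ _ h u.1).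

Lemma hom_map1 (X : prod_cat (op_cat C) C) :
  hom_map (idm X) = idm (hom_obj X).
Proof. by apply/funext => h; rewrite /hom_map /= comp1m compm1. Qed.

Lemma hom_mapM (X Y Z : prod_cat (op_cat C) C) (v : hom Y Z) (u : hom X Y) :
  hom_map (v ∘ u) = hom_map v ∘ hom_map u.
Proof. by apply/funext => h; rewrite /hom_map /= !compmA. Qed.

(* Hom_C(-,-) : C^op x C -> Set *)
Definition hom_functor : functor (prod_cat (op_cat C) C) type_cat :=
  Functor hom_map1 hom_mapM.

End HomFunctor.

Section FunctorProperties.
Variables (C D : category) (F : functor C D).

(* Hom_D(F-,F-) : C^op x C -> Set *)
Definition hom_functor_along : functor (prod_cat (op_cat C) C) type_cat :=
  hom_functor D \oF prod_functor (op_functor F) F.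

Definition fmap_component (X : prod_cat (op_cat C) C) :
    hom (hom_functor C X) (hom_functor_along X) :=
  fun h : @hom C X.1 X.2 => fmap F h.

Lemma fmap_natural (X Y : prod_cat (op_cat C) C) (u : hom X Y) :
  fmap hom_functor_along u ∘ @fmap_component X =
  @fmap_component Y ∘ fmap (hom_functor C) u.
Proof.
by apply/funext => h; rewrite /fmap_component /= /hom_map /= !fmapM.
Qed.

Definition fmap_nattrans : nattrans (hom_functor C) hom_functor_along :=
  Nattrans fmap_natural.

Definition naturally_full : Prop :=
  exists P : nattrans hom_functor_along (hom_functor C),
    fmap_nattrans \oN P = id_nattrans hom_functor_along.

Definition semiseparable : Prop :=
  exists P : nattrans hom_functor_along (hom_functor C),
    fmap_nattrans \oN P \oN fmap_nattrans = fmap_nattrans.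

Definition fully_faithful : Prop :=
  forall X Y : C, bijective (@fmap C D F X Y).

End FunctorProperties.

(* adjunction F G is the data of F -| G, i.e. F is left adjoint to G. *)
Record adjunction (C D : category) (F : functor C D) (G : functor D C) :=
  Adjunction {
    unit : nattrans (id_functor C) (G \oF F);
    counit : nattrans (F \oF G) (id_functor D);
    triangleL : forall X : C, counit (F X) ∘ fmap F (unit X) = idm (F X);
    triangleR : forall Y : D, fmap G (counit Y) ∘ unit (G Y) = idm (G Y) }.

Section AdjointProperties.
Variables (C D : category) (G : functor D C).

Definition coreflection : Prop :=
  exists F : functor C D, inhabited (adjunction F G) /\ fully_faithful F.

Definition reflection : Prop :=
  exists F : functor C D, inhabited (adjunction G F) /\ fully_faithful F.

Definition frobenius : Prop :=
  exists F : functor C D,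
    inhabited (adjunction F G) /\ inhabited (adjunction G F).

Definition bireflection : Prop :=
  exists (F : functor C D) (FG : adjunction F G) (GF : adjunction G F),
    fully_faithful F /\ unit GF \oN counit FG = id_nattrans (F \oF G).

End AdjointProperties.

(* Main.v *)
(* If P is a semiseparability structure on a coreflection F -| G with unit eta
   and counit eps, then gamma := P (eta G) satisfies gamma o eps = id, because
   gamma o eps = P (id) and G is injective on morphisms out of the image of F;
   gamma and eta^-1 are then the unit and counit of G -| F.  Conversely, if
   F -| G -| F' with F a left and F' a two-sided adjoint, then F' is isomorphic
   to F, hence fully faithful, and f |-> eps o F f o gamma (up to a correcting
   automorphism) makes G naturally full.  The statements about reflections
   are those about coreflections in the opposite categories. *)
Require Import Defs.
From mathcomp Require Import all_boot.
From mathcomp Require Import boolp.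

Set Implicit Arguments.
Unset Strict Implicit.
Unset Printing Implicit Defensive.

Local Open Scope cat_scope.

(** * Natural fullness and semiseparability in terms of families of maps on hom-sets *)

Section HomRetraction.
Variables (C D : category) (G : functor D C).

(** Naturality over [prod_cat (op_cat D) D], with the pairs unbundled and bracketed as in
    [hom_map]. *)
Definition natural_lift (P : forall X Y : D, hom (G X) (G Y) -> hom X Y) : Prop :=
  forall (X X' Y Y' : D) (u : hom X' X) (v : hom Y Y') (h : hom (G X) (G Y)),
    P X' Y' (fmap G v ∘ (h ∘ fmap G u)) = v ∘ (P X Y h ∘ u).

Section Nattrans.
Variable P : forall X Y : D, hom (G X) (G Y) -> hom X Y.
Hypothesis Pnat : natural_lift P.

Let lift_component (X : prod_cat (op_cat D) D) :
    hom (hom_functor_along G X) (hom_functor D X) :=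
  fun h : hom (G X.1) (G X.2) => @P X.1 X.2 h.

Lemma lift_natural (X Y : prod_cat (op_cat D) D) (u : hom X Y) :
  fmap (hom_functor D) u ∘ @lift_component X =
  @lift_component Y ∘ fmap (hom_functor_along G) u.
Proof. by apply/funext => h; symmetry; apply: Pnat. Qed.

Definition lift_nattrans : nattrans (hom_functor_along G) (hom_functor D) :=
  Nattrans lift_natural.

End Nattrans.

Lemma nattrans_lift (P : nattrans (hom_functor_along G) (hom_functor D)) :
  natural_lift (fun X Y => P (X, Y)).
Proof.
move=> X X' Y Y' u v h.
exact: (esym (congr1 (fun k => k h)
  (@naturality _ _ _ _ P (X, Y) (X', Y') (u, v)))).
Qed.

Lemma naturally_fullP :
  naturally_full G <->
  exists2 P, natural_lift P &
    forall (X Y : D) (h : hom (G X) (G Y)), fmap G (P X Y h) = h.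
Proof.
split=> [[P PK]|[P Pnat PK]].
  exists (fun X Y => P (X, Y)); first exact: nattrans_lift.
  by move=> X Y h; exact: (congr1
    (fun a : nattrans (hom_functor_along G) _ => a (X, Y) h) PK).
exists (lift_nattrans Pnat); apply: nattrans_ext => -[X Y].
by apply/funext => h; apply: PK.
Qed.

Lemma semiseparableP :
  semiseparable G <->
  exists2 P, natural_lift P &
    forall (X Y : D) (f : hom X Y), fmap G (P X Y (fmap G f)) = fmap G f.
Proof.
split=> [[P PK]|[P Pnat PK]].
  exists (fun X Y => P (X, Y)); first exact: nattrans_lift.
  by move=> X Y f; exact: (congr1
    (fun a : nattrans (hom_functor D) (hom_functor_along G) => a (X, Y) f) PK).
exists (lift_nattrans Pnat); apply: nattrans_ext => -[X Y].
by apply/funext => f; apply: PK.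
Qed.

Lemma naturally_full_semiseparable : naturally_full G -> semiseparable G.
Proof.
move=> /naturally_fullP[P Pnat PK]; apply/semiseparableP.
by exists P => // X Y f; apply: PK.
Qed.

End HomRetraction.

(** * Adjunctions whose left adjoint is fully faithful *)

Section AdjunctionTheory.
Variables (C D : category) (F : functor C D) (G : functor D C).
Variable A : adjunction F G.

(* The components of the unit and counit, typed without [id_functor] and
   [\oF], so that the naturality squares below can be rewritten with. *)
Definition eta (X : C) : hom X (G (F X)) := Defs.unit A X.
Definition eps (Y : D) : hom (F (G Y)) Y := counit A Y.

Lemma eta_natural (X Y : C) (f : hom X Y) :
  fmap G (fmap F f) ∘ eta X = eta Y ∘ f.
Proof. exact: (naturality (Defs.unit A) f). Qed.

Lemma eps_natural (X Y : D) (f : hom X Y) :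
  f ∘ eps X = eps Y ∘ fmap F (fmap G f).
Proof. exact: (naturality (counit A) f). Qed.

Lemma eps_eta (X : C) : eps (F X) ∘ fmap F (eta X) = idm (F X).
Proof. exact: triangleL. Qed.

Lemma eta_eps (Y : D) : fmap G (eps Y) ∘ eta (G Y) = idm (G Y).
Proof. exact: triangleR. Qed.

Lemma transposeK (X : C) (Y : D) (f : hom (F X) Y) :
  eps Y ∘ fmap F (fmap G f ∘ eta X) = f.
Proof. by rewrite fmapM compmA -eps_natural -compmA eps_eta compm1. Qed.

Lemma transpose_inj (X : C) (Y : D) (f g : hom (F X) Y) :
  fmap G f ∘ eta X = fmap G g ∘ eta X -> f = g.
Proof. by move=> e; rewrite -(transposeK f) e transposeK. Qed.

(** Naturality of [nu] is not demanded: it follows from that of [eta] once the components are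
    inverse. *)
Definition unit_inverse (nu : forall X : C, hom (G (F X)) X) : Prop :=
  (forall X, nu X ∘ eta X = idm X) /\ (forall X, eta X ∘ nu X = idm (G (F X))).

Lemma fully_faithful_unitP :
  fully_faithful F <-> exists nu, unit_inverse nu.
Proof.
split=> [Fff|[nu [nuK etaK]] X Y].
  (* By fullness the counit at [F X] has a preimage under [F]; it is the inverse of the unit. *)
  have nu X : {n : hom (G (F X)) X | fmap F n = eps (F X)}.
    by apply: cid; have [g _ gK] := Fff (G (F X)) X; exists (g (eps (F X))).
  exists (fun X => sval (nu X)); split=> X; case: (nu X) => n /= nE.
    by apply: (bij_inj (Fff X X)); rewrite fmapM fmap1 nE eps_eta.
  by rewrite -eta_natural nE eta_eps.
(* Conversely, a preimage of [h] is its transpose followed by the inverse of the unit. *)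
exists (fun h => nu Y ∘ (fmap G h ∘ eta X)) => [f|h].
  by rewrite eta_natural compmA nuK comp1m.
by apply: transpose_inj; rewrite eta_natural compmA etaK comp1m.
Qed.

Lemma unit_inverse_natural nu : unit_inverse nu ->
  forall (X Y : C) (f : hom X Y), f ∘ nu X = nu Y ∘ fmap G (fmap F f).
Proof.
move=> [nuK etaK] X Y f.
rewrite -[RHS]compm1 -etaK compmA -(compmA (nu Y)) eta_natural.
by rewrite compmA nuK comp1m.
Qed.

(** By a triangle identity both sides are left inverses of the invertible [eta A (G Y)]. *)
Lemma unit_inverse_eps nu : unit_inverse nu ->
  forall Y : D, nu (G Y) = fmap G (eps Y).
Proof.
move=> [nuK etaK] Y.
by rewrite -[LHS]comp1m -eta_eps -compmA etaK compm1.
Qed.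

Lemma fmap_unit_inverse nu : unit_inverse nu ->
  forall X : C, fmap F (nu X) = eps (F X).
Proof.
move=> [nuK etaK] X.
by rewrite -[LHS]comp1m -eps_eta -compmA -fmapM etaK fmap1 compm1.
Qed.

End AdjunctionTheory.

(** * Full faithfulness passes between left adjoints of the same functor *)

Section LeftAdjointUniqueness.
Variables (C D : category) (F F' : functor C D) (G : functor D C).

Definition left_adjoint_comparison (A : adjunction F G) (A' : adjunction F' G)
  (X : C) : hom (F X) (F' X) := eps A (F' X) ∘ fmap F (eta A' X).

Lemma left_adjoint_comparison_unit (A : adjunction F G) (A' : adjunction F' G)
    (X : C) :
  fmap G (left_adjoint_comparison A A' X) ∘ eta A X = eta A' X.
Proof.
by rewrite fmapM -compmA eta_natural compmA eta_eps comp1m.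
Qed.

End LeftAdjointUniqueness.

Lemma fully_faithful_left_adjoint (C D : category) (F F' : functor C D)
    (G : functor D C) (A : adjunction F G) (A' : adjunction F' G) :
  fully_faithful F -> fully_faithful F'.
Proof.
move=> /(fully_faithful_unitP A)[nu [nuK etaK]].
pose th := left_adjoint_comparison A' A; pose th' := left_adjoint_comparison A A'.
have thE X : fmap G (th X) ∘ eta A' X = eta A X.
  exact: left_adjoint_comparison_unit.
have thE' X : fmap G (th' X) ∘ eta A X = eta A' X.
  exact: left_adjoint_comparison_unit.
have thK X : th' X ∘ th X = idm (F' X).
  by apply: (transpose_inj (A := A')); rewrite fmapM -compmA thE thE' fmap1 comp1m.
(* The unit of [A'] is that of [A] followed by [G] of the comparison [th'], so it is inverted by
   undoing [th'] with [th], then applying [nu]. *)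
apply/(fully_faithful_unitP A'); exists (fun X => nu X ∘ fmap G (th X)).
split=> X; first by rewrite -compmA thE nuK.
by rewrite -thE' -compmA (compmA (eta A X)) etaK comp1m -fmapM thK fmap1.
Qed.

(** * Frobenius coreflections are naturally full *)

Section FrobeniusNaturallyFull.
Variables (C D : category) (F : functor C D) (G : functor D C).
Variables (A : adjunction F G) (B : adjunction G F).

(* The composite [eps B ∘ eta A], an automorphism of the identity when [F] is
   fully faithful, corrects for the two adjunctions not being assumed
   compatible. *)
Definition frobenius_lift (X Y : D) (f : hom (G X) (G Y)) : hom X Y :=
  eps A Y ∘ (fmap F (f ∘ (eps B (G X) ∘ eta A (G X))) ∘ eta B X).

Lemma frobenius_lift_natural : natural_lift frobenius_lift.
Proof.
move=> X X' Y Y' u v h; rewrite /frobenius_lift.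
(* The correcting endomorphism is natural, so it moves past [fmap G u]. *)
have -> : fmap G v ∘ (h ∘ fmap G u) ∘ (eps B (G X') ∘ eta A (G X')) =
    fmap G v ∘ (h ∘ (eps B (G X) ∘ eta A (G X))) ∘ fmap G u.
  rewrite -!compmA; congr (_ ∘ (_ ∘ _)).
  by rewrite compmA eps_natural -compmA eta_natural.
rewrite (fmapM F _ (fmap G u)) -(compmA _ (fmap F (fmap G u))) eta_natural.
by rewrite fmapM !compmA -eps_natural.
Qed.

Lemma frobenius_naturally_full : fully_faithful F -> naturally_full G.
Proof.
move=> /(fully_faithful_unitP A)[nu nuP]; have [nuK etaK] := nuP.
apply/naturally_fullP; exists frobenius_lift => [|X Y h].
  exact: frobenius_lift_natural.
(* The two agree after precomposition with [eta A Z], which is invertible. *)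
have GFeta Z : fmap G (fmap F (eta A Z)) = eta A (G (F Z)).
  by rewrite -[LHS]compm1 -etaK compmA eta_natural -compmA etaK compm1.
(* With [GFeta] the unit of [A] slides left by naturality until it cancels against [G] of the
   counit; what remains is [h] composed with a triangle of [B]. *)
rewrite /frobenius_lift compmA !fmapM GFeta !compmA -(compmA _ _ (eta A _)).
rewrite eta_natural compmA -(compmA _ _ (eta A _)) eta_natural compmA eta_eps.
by rewrite comp1m -compmA eps_eta compm1.
Qed.

End FrobeniusNaturallyFull.

Lemma frobenius_coreflection (C D : category) (G : functor D C) :
  frobenius G -> coreflection G -> naturally_full G /\ reflection G.
Proof.
move=> [F' [[A'] [B]]] [F [[A] Fff]].
have F'ff := fully_faithful_left_adjoint A A' Fff.
by split; [exact: frobenius_naturally_full A' B F'ff | exists F'].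
Qed.

(** * Semiseparable coreflections are bireflections *)

Section SemiseparableCoreflection.
Variables (C D : category) (F : functor C D) (G : functor D C).
Variable A : adjunction F G.
Variable P : forall X Y : D, hom (G X) (G Y) -> hom X Y.
Hypothesis Pnat : natural_lift P.
Hypothesis PK : forall (X Y : D) (f : hom X Y),
  fmap G (P (fmap G f)) = fmap G f.
Variable nu : forall X : C, hom (G (F X)) X.
Hypothesis nuP : unit_inverse A nu.

Definition lifted_unit (Y : D) : hom Y (F (G Y)) := P (eta A (G Y)).

Lemma lift_postcomp (X Y Y' : D) (v : hom Y Y') (h : hom (G X) (G Y)) :
  P (fmap G v ∘ h) = v ∘ P h.
Proof. by have := Pnat (idm X) v h; rewrite fmap1 !compm1. Qed.

Lemma lift_precomp (X X' Y : D) (u : hom X' X) (h : hom (G X) (G Y)) :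
  P (h ∘ fmap G u) = P h ∘ u.
Proof. by have := Pnat u (idm Y) h; rewrite fmap1 !comp1m. Qed.

Lemma lifted_unit_natural (X Y : D) (f : hom X Y) :
  fmap F (fmap G f) ∘ lifted_unit X = lifted_unit Y ∘ f.
Proof. by rewrite -lift_postcomp eta_natural lift_precomp. Qed.

(* [G] is injective on morphisms out of the image of [F], so [P] fixes the
   identity of [F (G Y)]. *)
Lemma lifted_unit_eps (Y : D) : lifted_unit Y ∘ eps A Y = idm (F (G Y)).
Proof.
have [_ etaK] := nuP.
rewrite -lift_precomp -(unit_inverse_eps nuP) etaK -fmap1.
by apply: (transpose_inj (A := A)); rewrite PK.
Qed.

(** The left side is a left inverse of [fmap G (eps A Y)] and the right side a right inverse, so
    they coincide. *)
Lemma fmap_lifted_unit (Y : D) : fmap G (lifted_unit Y) = eta A (G Y).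
Proof.
have [_ etaK] := nuP.
rewrite -[LHS]compm1 -(eta_eps A Y) compmA -fmapM lifted_unit_eps fmap1.
by rewrite comp1m.
Qed.

Definition lifted_unit_nattrans : nattrans (id_functor D) (F \oF G) :=
  @Nattrans _ _ (id_functor D) (F \oF G) lifted_unit lifted_unit_natural.

Definition unit_inverse_nattrans : nattrans (G \oF F) (id_functor C) :=
  @Nattrans _ _ (G \oF F) (id_functor C) nu (unit_inverse_natural nuP).

Lemma lifted_triangleL (Y : D) :
  nu (G Y) ∘ fmap G (lifted_unit Y) = idm (G Y).
Proof. by have [nuK _] := nuP; rewrite fmap_lifted_unit nuK. Qed.

(** Since [fmap F (nu X)] is the counit at [F X], which has the right inverse [fmap F (eta A X)],
    its left inverse [lifted_unit (F X)] is two-sided. *)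
Lemma lifted_triangleR (X : C) :
  fmap F (nu X) ∘ lifted_unit (F X) = idm (F X).
Proof.
rewrite (fmap_unit_inverse nuP) -[LHS]compm1 -(eps_eta A X) compmA.
by rewrite -(compmA (eps A (F X))) lifted_unit_eps compm1.
Qed.

Definition lifted_adjunction : adjunction G F :=
  @Adjunction _ _ G F lifted_unit_nattrans unit_inverse_nattrans
    lifted_triangleL lifted_triangleR.

End SemiseparableCoreflection.

Lemma semiseparable_coreflection (C D : category) (G : functor D C) :
  semiseparable G -> coreflection G -> bireflection G.
Proof.
move=> /semiseparableP[P Pnat PK] [F [[A] Fff]].
have /(fully_faithful_unitP A)[nu nuP] := Fff.
exists F, A, (lifted_adjunction Pnat PK nuP); split=> //.
by apply: nattrans_ext => Y; apply: (lifted_unit_eps Pnat PK nuP).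
Qed.

Lemma bireflection_frobenius (C D : category) (G : functor D C) :
  bireflection G -> frobenius G.
Proof. by move=> [F [A [B _]]]; exists F. Qed.

Lemma bireflection_coreflection (C D : category) (G : functor D C) :
  bireflection G -> coreflection G.
Proof. by move=> [F [A [_ [Fff _]]]]; exists F. Qed.

(** * Duality *)

(** Brings back adjoints found between opposite categories without identifying [op_cat (op_cat C)]
    with [C]. *)
Definition unop_functor (C D : category) (F : functor (op_cat C) (op_cat D)) :
    functor C D :=
  @Functor C D F (fun X Y f => @fmap _ _ F Y X f)
    (fun X => fmap1 F X) (fun _ _ _ g f => fmapM F f g).

Section OppositeAdjunction.
Variables (C D : category).

Definition op_adjunction (F : functor C D) (G : functor D C)
    (A : adjunction F G) : adjunction (op_functor G) (op_functor F) :=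
  @Adjunction (op_cat D) (op_cat C) (op_functor G) (op_functor F)
    (@Nattrans _ _ (id_functor _) (op_functor F \oF op_functor G)
       (fun Y => eps A Y) (fun X Y f => esym (eps_natural A f)))
    (@Nattrans _ _ (op_functor G \oF op_functor F) (id_functor _)
       (fun X => eta A X) (fun X Y f => esym (eta_natural A f)))
    (fun Y => eta_eps A Y) (fun X => eps_eta A X).

Definition unop_adjunction (F : functor (op_cat C) (op_cat D))
    (G : functor (op_cat D) (op_cat C)) (A : adjunction F G) :
    adjunction (unop_functor G) (unop_functor F) :=
  @Adjunction D C (unop_functor G) (unop_functor F)
    (@Nattrans _ _ (id_functor _) (unop_functor F \oF unop_functor G)
       (fun Y => eps A Y) (fun X Y f => esym (@eps_natural _ _ _ _ A Y X f)))
    (@Nattrans _ _ (unop_functor G \oF unop_functor F) (id_functor _)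
       (fun X => eta A X) (fun X Y f => esym (@eta_natural _ _ _ _ A Y X f)))
    (fun Y => eta_eps A Y) (fun X => eps_eta A X).

End OppositeAdjunction.

Section Duality.
Variables (C D : category) (G : functor D C).

Lemma unop_op_functor : unop_functor (op_functor G) = G.
Proof. by case: G => *; congr Functor. Qed.

Lemma op_frobenius : frobenius G -> frobenius (op_functor G).
Proof.
move=> [F [[A] [B]]]; exists (op_functor F).
by split; constructor; apply: op_adjunction.
Qed.

Lemma unop_frobenius : frobenius (op_functor G) -> frobenius G.
Proof.
move=> [F [[A] [B]]]; exists (unop_functor F); rewrite -unop_op_functor.
by split; constructor; apply: unop_adjunction.
Qed.

Lemma op_reflection : reflection G -> coreflection (op_functor G).
Proof.
move=> [F [[A] Fff]]; exists (op_functor F); split.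
  by constructor; apply: op_adjunction.
by move=> X Y; apply: Fff.
Qed.

Lemma unop_reflection : reflection (op_functor G) -> coreflection G.
Proof.
move=> [F [[A] Fff]]; exists (unop_functor F); split.
  by rewrite -unop_op_functor; constructor; apply: unop_adjunction.
by move=> X Y; apply: Fff.
Qed.

Lemma op_semiseparable : semiseparable G -> semiseparable (op_functor G).
Proof.
move=> /semiseparableP[P Pnat PK]; apply/semiseparableP.
exists (fun X Y h => P Y X h) => [X X' Y Y' u v h|X Y f] /=; last exact: PK.
by rewrite -!compmA; apply: Pnat.
Qed.

Lemma unop_naturally_full : naturally_full (op_functor G) -> naturally_full G.
Proof.
move=> /naturally_fullP[P Pnat PK]; apply/naturally_fullP.
exists (fun X Y h => P Y X h) => [X X' Y Y' u v h|X Y h]; last exact: PK.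
by rewrite !compmA; apply: (Pnat _ _ _ _ v u h).
Qed.

End Duality.

(** * The cycle of implications *)

Theorem theorem2p24 (C D : category) (G : functor D C) :
  [<-> naturally_full G /\ coreflection G;
       semiseparable G /\ coreflection G;
       bireflection G;
       frobenius G /\ coreflection G;
       naturally_full G /\ reflection G;
       semiseparable G /\ reflection G;
       frobenius G /\ reflection G].
Proof.
tfae.
- by move=> [/naturally_full_semiseparable].
- by move=> [/semiseparable_coreflection]; apply.
- move=> Gbi; split; first exact: bireflection_frobenius.
  exact: bireflection_coreflection.
- by move=> [/frobenius_coreflection]; apply.
- by move=> [/naturally_full_semiseparable].
(* In the opposite categories this is a semiseparable coreflection, hence Frobenius, and the
   Frobenius property is self-dual. *)
- move=> [/op_semiseparable Gss Gr]; split=> //.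
  apply/unop_frobenius/bireflection_frobenius.
  exact: semiseparable_coreflection Gss (op_reflection Gr).
(* Dually, a Frobenius coreflection is naturally full and a reflection; dualising back closes the
   cycle. *)
- move=> [/op_frobenius Gf /op_reflection Gr].
  have [Gnf Gcr] := frobenius_coreflection Gf Gr.
  by split; [exact: unop_naturally_full | exact: unop_reflection].
Qed.
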